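(* Let $O$ be the origin of $\mathbb{R}^3$ and let $(x(t),y(t),z(t))$, $t_0\le t\le t_1$, be a simple curve of class $C^2$ in $\mathbb{R}^3$ that does not pass through $O$ and does not meet any of the coordinate axes. Suppose that $P=P(t)$ is a moving point in $\mathbb{R}^3$ (such that the projections $\overrightarrow{OP}_A,\overrightarrow{OP}_B,\overrightarrow{OP}_C$ of $\overrightarrow{OP}$ onto the coordinate planes are nonzero) satisfying, for $t_0\le t\le t_1$, the following conditions: 1) for $\mathcal{D}=|\overrightarrow{OP}|$, $$\begin{aligned}\frac{d^2\mathcal{D}}{dt^2}=&-(x^2(t)+y^2(t)+z^2(t))^{-3/2}\,(x(t)x'(t)+y(t)y'(t)+z(t)z'(t))^2\\&+(x^2(t)+y^2(t)+z^2(t))^{-1/2}\,(x'^2(t)+x(t)x''(t)+y'^2(t)+y(t)y''(t)+z'^2(t)+z(t)z''(t)),\end{aligned}$$ $$\frac{d\mathcal{D}}{dt}\Big|_{t=t_0}=\frac{x(t_0)x'(t_0)+y(t_0)y'(t_0)+z(t_0)z'(t_0)}{\sqrt{x^2(t_0)+y^2(t_0)+z^2(t_0)}},\qquad \mathcal{D}|_{t=t_0}=\sqrt{x^2(t_0)+y^2(t_0)+z^2(t_0)};$$ 2) $$\frac{d\vec e_{\overrightarrow{OP}_A}}{dt}=(x(t)y'(t)-x'(t)y(t))\frac{(-y(t),x(t),0)}{(x^2(t)+y^2(t))^{3/2}},\qquad \vec e_{\overrightarrow{OP}_A}|_{t=t_0}=\frac{(x(t_0),y(t_0),0)}{\sqrt{x^2(t_0)+y^2(t_0)}};$$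 3) $$\frac{d\vec e_{\overrightarrow{OP}_B}}{dt}=(x(t)z'(t)-x'(t)z(t))\frac{(-z(t),0,x(t))}{(x^2(t)+z^2(t))^{3/2}},\qquad \vec e_{\overrightarrow{OP}_B}|_{t=t_0}=\frac{(x(t_0),0,z(t_0))}{\sqrt{x^2(t_0)+z^2(t_0)}};$$ 4) $$\frac{d\vec e_{\overrightarrow{OP}_C}}{dt}=(y(t)z'(t)-y'(t)z(t))\frac{(0,-z(t),y(t))}{(y^2(t)+z^2(t))^{3/2}},\qquad \vec e_{\overrightarrow{OP}_C}|_{t=t_0}=\frac{(0,y(t_0),z(t_0))}{\sqrt{y^2(t_0)+z^2(t_0)}}.$$ Then the trajectory of $P$ is $\vec r(t)=(x(t),y(t),z(t))$, $t_0\le t\le t_1$; that is, $\overrightarrow{OP}(t)=(x(t),y(t),z(t))$ for all $t\in[t_0,t_1]$.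
   Context: $\overrightarrow{OP}_A$, $\overrightarrow{OP}_B$, $\overrightarrow{OP}_C$ denote the orthogonal projections of $\overrightarrow{OP}$ onto the $xOy$, $xOz$ and $yOz$ planes, respectively. $\vec e_{\vec w}=\vec w/|\vec w|$ denotes the unit vector in the direction of a nonzero vector $\vec w$. *)

(* Defs.v *)
From Stdlib Require Import Reals Lra.
From Coquelicot Require Import Coquelicot.

Open Scope R_scope.

Definition R3 : NormedModule R_AbsRing :=
  prod_NormedModule R_AbsRing
    (prod_NormedModule R_AbsRing R_NormedModule R_NormedModule)
    R_NormedModule.

Definition vec3 (a b c : R) : R3 := (a, b, c).

(* Coquelicot's product norm is the l2 combination of the component norms, so
   the library norm on R3 is the Euclidean one. *)
Lemma norm_vec3 (a b c : R) :
  norm (vec3 a b c) = sqrt (a ^ 2 + b ^ 2 + c ^ 2).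
Proof.
  change (sqrt (sqrt (Rabs a ^ 2 + Rabs b ^ 2) ^ 2 + Rabs c ^ 2)
          = sqrt (a ^ 2 + b ^ 2 + c ^ 2)).
  rewrite pow2_sqrt.
  - now rewrite !pow2_abs.
  - apply Rplus_le_le_0_compat; apply pow2_ge_0.
Qed.

Definition proj_A (v : R3) : R3 := vec3 (fst (fst v)) (snd (fst v)) 0.
Definition proj_B (v : R3) : R3 := vec3 (fst (fst v)) 0 (snd v).
Definition proj_C (v : R3) : R3 := vec3 0 (snd (fst v)) (snd v).

(* Meaningful for w <> 0 only. *)
Definition unit_vec (w : R3) : R3 := scal (/ norm w) w.

Definition Icc (a b : R) : R -> Prop := fun t => a <= t <= b.

(* Derivative relative to [a, b]: two-sided in the interior, one-sided at the
   endpoints; values of f outside [a, b] play no role. *)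
Definition is_derive_on (a b : R) {V : NormedModule R_AbsRing}
    (f : R -> V) (t : R) (l : V) : Prop :=
  filterdiff f (within (Icc a b) (locally t)) (fun h : R => scal h l).

Definition is_C2_on (a b : R) (f f' f'' : R -> R) : Prop :=
  (forall t, Icc a b t -> is_derive_on a b f t (f' t)) /\
  (forall t, Icc a b t -> is_derive_on a b f' t (f'' t)) /\
  continuous_on (Icc a b) f''.

(* No self-intersection, except that the two endpoints may coincide
   (simple closed curves are allowed). *)
Definition is_simple_on (a b : R) (r : R -> R3) : Prop :=
  forall s t, Icc a b s -> Icc a b t -> s < t -> r s = r t -> s = a /\ t = b.

(* Main.v *)
(* The distance |OP| and the three unit vectors have the same derivatives and the
   same initial values as those of r = (x, y, z), hence agree with them on
   [t0, t1]. So the projections of OP are positive multiples of those of r;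
   since at most one coordinate of r vanishes at any time, the three factors can
   be taken equal to a common k > 0, and |OP| = |r| forces k = 1. *)

Require Import Defs.
From Stdlib Require Import Reals Lra.
From Coquelicot Require Import Coquelicot.

Open Scope R_scope.

(** * Calculus of derivatives relative to a closed interval *)

Section RelativeDerivative.

Context (a b t : R) (ht : Icc a b t).

(** Since [t] itself lies in [[a, b]], every set of the filter meets the interval, at [t] at
    least. *)
#[local] Instance within_Icc_proper :
  ProperFilter (within (Icc a b) (locally t)).
Proof.
  split; [intros P HP | apply within_filter, locally_filter].
  exists t; exact (locally_singleton _ _ HP ht).
Qed.

Lemma within_Icc_lim : is_filter_lim (within (Icc a b) (locally t)) t.
Proof. exact (filter_le_within _). Qed.

Lemma is_derive_on_filterlim {V : NormedModule R_AbsRing} (f : R -> V) (l : V) :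
  is_derive_on a b f t l ->
  filterlim f (within (Icc a b) (locally t)) (locally (f t)).
Proof.
  intros Hf; apply (filterdiff_continuous_aux (U := R_NormedModule) f).
  - eexists; exact Hf.
  - exact within_Icc_lim.
Qed.

Lemma is_derive_on_eq (f : R -> R) (l m : R) :
  l = m -> is_derive_on a b f t l -> is_derive_on a b f t m.
Proof. now intros <-. Qed.

Lemma is_derive_on_plus (f g : R -> R) (l m : R) :
  is_derive_on a b f t l -> is_derive_on a b g t m ->
  is_derive_on a b (fun s => f s + g s) t (l + m).
Proof.
  intros Hf Hg.
  apply (filterdiff_ext_lin (U := R_NormedModule) (V := R_NormedModule)
           _ (fun h : R => plus (scal h l) (scal h m))).
  - exact (filterdiff_plus_fct (U := R_NormedModule) _ _ _ _ Hf Hg).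
  - intros h; symmetry; exact (scal_distr_l h l m).
Qed.

Lemma is_derive_on_mult (f g : R -> R) (l m : R) :
  is_derive_on a b f t l -> is_derive_on a b g t m ->
  is_derive_on a b (fun s => f s * g s) t (l * g t + f t * m).
Proof.
  intros Hf Hg.
  apply (filterdiff_ext_lin (U := R_NormedModule) (V := R_NormedModule)
           _ (fun h : R => plus (mult (scal h l) (g t)) (mult (f t) (scal h m)))).
  - refine (filterdiff_comp_2 (U := R_NormedModule) (V := R_NormedModule)
              (W := R_NormedModule) f g Rmult
              (fun h : R => scal h l) (fun h : R => scal h m)
              (fun u v : R => plus (mult u (g t)) (mult (f t) v)) Hf Hg _).
    refine (filterdiff_mult (K := R_AbsRing) (f t, g t) _ Rmult_comm).
    (* What remains is that the pair [(f, g)] tends to [(f t, g t)] along the relative filter. This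
       is the continuity of each factor, a ball of the product containing a product of balls. *)
    intros P HP.
    apply (filterlim_pair f g (is_derive_on_filterlim _ _ Hf)
             (is_derive_on_filterlim _ _ Hg)).
    destruct HP as [e He].
    exists (ball (f t) e) (ball (g t) e); try apply locally_ball.
    intros u v Hu Hv; apply He; now split.
  - intros h; unfold plus, mult, scal; simpl; unfold mult; simpl; ring.
Qed.

Lemma is_derive_on_comp (f g : R -> R) (l m : R) :
  is_derive g (f t) m -> is_derive_on a b f t l ->
  is_derive_on a b (fun s => g (f s)) t (l * m).
Proof.
  intros Hg Hf.
  apply (filterdiff_ext_lin (U := R_NormedModule) (V := R_NormedModule)
           _ (fun h : R => scal (scal h l) m)).
  - apply (filterdiff_comp (U := R_NormedModule) (V := R_NormedModule)
              (W := R_NormedModule) f g (fun h : R => scal h l) (fun u : R => scal u m) Hf).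
    refine (filterdiff_locally (U := R_NormedModule) g (f t) _ _ Hg).
    exact (is_derive_on_filterlim _ _ Hf).
  - intros h; symmetry; exact (scal_assoc h l m).
Qed.

Lemma is_derive_on_linear {V W : NormedModule R_AbsRing} (L : V -> W)
    (f : R -> V) (l : V) :
  is_linear L -> is_derive_on a b f t l ->
  is_derive_on a b (fun s => L (f s)) t (L l).
Proof.
  intros HL Hf.
  apply (filterdiff_ext_lin (U := R_NormedModule) _ (fun h : R => L (scal h l))).
  - exact (filterdiff_comp (U := R_NormedModule) f L _ L Hf (filterdiff_linear L HL)).
  - intros h; apply (linear_scal L HL).
Qed.

(** An interior point has a neighbourhood inside [[a, b]], so restricting the neighbourhood filter
    to the interval changes nothing there. *)
Lemma is_derive_on_interior {V : NormedModule R_AbsRing} (f : R -> V) (l : V) :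
  a < t < b -> is_derive_on a b f t l -> is_derive f t l.
Proof.
  intros [Ha Hb] [Hlin Hf]; split; [exact Hlin|].
  intros s Hs; replace s with t
    by exact (is_filter_lim_locally_unique (V := R_NormedModule) _ _ Hs).
  specialize (Hf t within_Icc_lim).
  apply (is_domin_le _ _ Hf); intros P HP.
  generalize (filter_and (F := locally t) _ _ HP
    (filter_and (F := locally t) _ _ (open_gt a t Ha) (open_lt b t Hb))).
  apply filter_imp; intros u [HPu [Hau Hub]].
  apply HPu; split; now apply Rlt_le.
Qed.

End RelativeDerivative.

(** * A function on a closed interval is determined by its derivative and initial value *)

Definition clamp (a b s : R) : R := Rmax a (Rmin b s).

Lemma clamp_id (a b s : R) : Icc a b s -> clamp a b s = s.
Proof.
  intros [Ha Hb]; unfold clamp.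
  now rewrite Rmin_right, Rmax_right.
Qed.

(** Clamping fixes [s] and never increases the distance to it, so the same radius [e] works on both
    sides. *)
Lemma clamp_filterlim (a b s : R) :
  Icc a b s -> filterlim (clamp a b) (locally s) (within (Icc a b) (locally s)).
Proof.
  intros [Ha Hb] P [e He]; exists e; intros u Hu.
  change (Rabs (u - s) < e) in Hu.
  apply He; [change (Rabs (clamp a b u - s) < e)|];
    revert Hu; unfold clamp, Icc, Rmin, Rmax, Rabs;
    repeat destruct Rle_dec; repeat destruct Rcase_abs; lra.
Qed.

Lemma is_derive_on_unique (a b : R) (f g h : R -> R) :
  (forall t, Icc a b t -> is_derive_on a b f t (h t)) ->
  (forall t, Icc a b t -> is_derive_on a b g t (h t)) ->
  f a = g a -> forall t, Icc a b t -> f t = g t.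
Proof.
  intros Hf Hg Hfg t Ht; pose proof Ht as [Ha Hb].
  (* [MVT_gen] asks for two-sided continuity at the endpoints too. Clamping the argument extends
     [f - g] by constants beyond [[a, b]], which provides it. *)
  set (k := fun s => f (clamp a b s) - g (clamp a b s)).
  destruct (MVT_gen k a t (fun _ => 0)) as [c [_ Hc]].
  - rewrite Rmin_left, Rmax_right by exact Ha; intros s Hs.
    assert (HI : Icc a b s) by (unfold Icc; lra).
    (* Near a point strictly between [a] and [t] the clamp is the identity, so [k] has derivative
       [h s - h s = 0] there. *)
    apply (is_derive_ext_loc (fun u => f u - g u)).
    + generalize (filter_and (F := locally s) _ _ (open_gt a s (proj1 Hs))
                    (open_lt t s (proj2 Hs))).
      apply filter_imp; intros u [Hu Hu']; unfold k.
      now rewrite clamp_id by (unfold Icc; lra).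
    + replace 0 with (minus (h s) (h s)) by (unfold minus, plus, opp; simpl; ring).
      apply (is_derive_minus (V := R_NormedModule));
        apply (is_derive_on_interior a b); auto; lra.
  - rewrite Rmin_left, Rmax_right by exact Ha; intros s Hs.
    assert (HI : Icc a b s) by (unfold Icc; lra).
    assert (Hcont : forall p : R -> R, is_derive_on a b p s (h s) ->
        continuity_pt (fun u => p (clamp a b u)) s).
    { intros p Hp; apply continuity_pt_filterlim.
      rewrite (clamp_id a b s HI).
      exact (filterlim_comp _ _ _ _ _ _ _ _ (clamp_filterlim a b s HI)
               (is_derive_on_filterlim a b s p _ Hp)). }
    exact (continuity_pt_minus _ _ _ (Hcont f (Hf s HI)) (Hcont g (Hg s HI))).
  - unfold k in Hc.
    rewrite !clamp_id in Hc by (unfold Icc; lra); lra.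
Qed.

(** * Relative derivatives of squares, square roots and their inverses *)

Lemma Rpower_3_2 (u : R) : 0 < u -> Rpower u (3 / 2) = u * sqrt u.
Proof.
  intros Hu; replace (3 / 2) with (1 + / 2) by lra.
  now rewrite Rpower_plus, Rpower_1, Rpower_sqrt.
Qed.

Section DerivativeRules.

Context (a b t : R) (ht : Icc a b t).

Lemma is_derive_on_pow2 (f : R -> R) (l : R) :
  is_derive_on a b f t l -> is_derive_on a b (fun s => f s ^ 2) t (2 * (f t * l)).
Proof.
  intros Hf; apply (is_derive_on_eq _ _ _ _ (l * (2 * f t))); [ring|].
  apply (is_derive_on_comp a b t ht f (fun u => u ^ 2)); [|exact Hf].
  auto_derive; [exact I | ring].
Qed.

Lemma is_derive_on_sqrt (f : R -> R) (l : R) :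
  0 < f t -> is_derive_on a b f t l ->
  is_derive_on a b (fun s => sqrt (f s)) t (l / (2 * sqrt (f t))).
Proof.
  intros Hpos; apply (is_derive_on_comp a b t ht f sqrt).
  auto_derive; [exact Hpos | now rewrite Rmult_1_l].
Qed.

Lemma is_derive_on_inv_sqrt (f : R -> R) (l : R) :
  0 < f t -> is_derive_on a b f t l ->
  is_derive_on a b (fun s => / sqrt (f s)) t (l * - / (2 * Rpower (f t) (3 / 2))).
Proof.
  intros Hpos; apply (is_derive_on_comp a b t ht f (fun u => / sqrt u)).
  rewrite Rpower_3_2 by exact Hpos.
  pose proof (sqrt_lt_R0 _ Hpos) as Hs; pose proof (sqrt_sqrt _ (Rlt_le _ _ Hpos)) as Hss.
  auto_derive; [lra|].
  (* Written as a cube of the root, the denominator makes both sides rational in [sqrt (f t)]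
     alone. *)
  replace (f t * sqrt (f t)) with (sqrt (f t) * sqrt (f t) * sqrt (f t))
    by now rewrite Hss.
  field; lra.
Qed.

End DerivativeRules.

(** * Integration of the equations for the unit directions and for the distance *)

Lemma sum_squares_pos (u v : R) : ~ (u = 0 /\ v = 0) -> 0 < u ^ 2 + v ^ 2.
Proof.
  intros Huv.
  destruct (Req_dec u 0) as [Hu|]; [destruct (Req_dec v 0)|]; [tauto|nra..].
Qed.

(** With [rho = sqrt (f^2 + g^2)], direct differentiation gives
    [(f / rho)' = - g (f g' - f' g) / rho^3] and [(g / rho)' = f (f g' - f' g) / rho^3], which are
    the prescribed derivatives of [U] and [V]. The pair [(f, g)] is generic so that one argument
    serves all three coordinate planes. *)
Lemma direction_unique (a b : R) (f g f' g' U V : R -> R) :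
  (forall t, Icc a b t -> ~ (f t = 0 /\ g t = 0)) ->
  (forall t, Icc a b t -> is_derive_on a b f t (f' t)) ->
  (forall t, Icc a b t -> is_derive_on a b g t (g' t)) ->
  (forall t, Icc a b t -> is_derive_on a b U t
     ((f t * g' t - f' t * g t)
      * (/ Rpower (f t ^ 2 + g t ^ 2) (3 / 2) * - g t))) ->
  (forall t, Icc a b t -> is_derive_on a b V t
     ((f t * g' t - f' t * g t)
      * (/ Rpower (f t ^ 2 + g t ^ 2) (3 / 2) * f t))) ->
  U a = / sqrt (f a ^ 2 + g a ^ 2) * f a ->
  V a = / sqrt (f a ^ 2 + g a ^ 2) * g a ->
  forall t, Icc a b t ->
    U t = / sqrt (f t ^ 2 + g t ^ 2) * f t /\
    V t = / sqrt (f t ^ 2 + g t ^ 2) * g t.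
Proof.
  intros Hfg Hf Hg HU HV HUa HVa t Ht.
  assert (Hpos : forall s, Icc a b s -> 0 < f s ^ 2 + g s ^ 2).
  { intros s Hs; apply sum_squares_pos; auto. }
  assert (Hinv : forall s, Icc a b s ->
    is_derive_on a b (fun u => / sqrt (f u ^ 2 + g u ^ 2)) s
      ((2 * (f s * f' s) + 2 * (g s * g' s))
       * - / (2 * Rpower (f s ^ 2 + g s ^ 2) (3 / 2)))).
  { intros s Hs.
    apply (is_derive_on_inv_sqrt a b s Hs (fun u => f u ^ 2 + g u ^ 2));
      [exact (Hpos s Hs)|].
    apply is_derive_on_plus; apply is_derive_on_pow2; auto. }
  split.
  - revert t Ht; eapply is_derive_on_unique; [exact HU| |exact HUa].
    intros s Hs; cbv beta.
    eapply is_derive_on_eq;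
      [|exact (is_derive_on_mult a b s Hs _ _ _ _ (Hinv s Hs) (Hf s Hs))].
    rewrite Rpower_3_2 by auto.
    pose proof (Hpos s Hs) as Hp; pose proof (sqrt_lt_R0 _ Hp).
    field; split; lra.
  - revert t Ht; eapply is_derive_on_unique; [exact HV| |exact HVa].
    intros s Hs; cbv beta.
    eapply is_derive_on_eq;
      [|exact (is_derive_on_mult a b s Hs _ _ _ _ (Hinv s Hs) (Hg s Hs))].
    rewrite Rpower_3_2 by auto.
    pose proof (Hpos s Hs) as Hp; pose proof (sqrt_lt_R0 _ Hp).
    field; split; lra.
Qed.

(** The second-order equation is integrated twice. Put [N = x^2 + y^2 + z^2] and
    [S = x x' + y y' + z z'], so that [N' = 2 S]; the given second derivative is that of [sqrt N],
    namely [(S / sqrt N)']. *)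
Lemma distance_unique (a b : R) (x y z x' y' z' x'' y'' z'' D D' : R -> R) :
  (forall t, Icc a b t -> 0 < x t ^ 2 + y t ^ 2 + z t ^ 2) ->
  is_C2_on a b x x' x'' -> is_C2_on a b y y' y'' -> is_C2_on a b z z' z'' ->
  (forall t, Icc a b t -> is_derive_on a b D t (D' t)) ->
  (forall t, Icc a b t -> is_derive_on a b D' t
     (- Rpower (x t ^ 2 + y t ^ 2 + z t ^ 2) (- (3 / 2))
        * (x t * x' t + y t * y' t + z t * z' t) ^ 2
      + Rpower (x t ^ 2 + y t ^ 2 + z t ^ 2) (- (1 / 2))
        * (x' t ^ 2 + x t * x'' t + y' t ^ 2 + y t * y'' t
           + z' t ^ 2 + z t * z'' t))) ->
  D' a = (x a * x' a + y a * y' a + z a * z' a)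
         / sqrt (x a ^ 2 + y a ^ 2 + z a ^ 2) ->
  D a = sqrt (x a ^ 2 + y a ^ 2 + z a ^ 2) ->
  forall t, Icc a b t -> D t = sqrt (x t ^ 2 + y t ^ 2 + z t ^ 2).
Proof.
  intros Hpos [Hx [Hx' _]] [Hy [Hy' _]] [Hz [Hz' _]] HD HD' HD'a HDa.
  assert (HN : forall s, Icc a b s ->
    is_derive_on a b (fun u => x u ^ 2 + y u ^ 2 + z u ^ 2) s
      (2 * (x s * x' s) + 2 * (y s * y' s) + 2 * (z s * z' s))).
  { intros s Hs; apply is_derive_on_plus; [apply is_derive_on_plus|];
      apply is_derive_on_pow2; auto. }
  assert (HS : forall s, Icc a b s ->
    is_derive_on a b (fun u => x u * x' u + y u * y' u + z u * z' u) s
      ((x' s * x' s + x s * x'' s) + (y' s * y' s + y s * y'' s)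
       + (z' s * z' s + z s * z'' s))).
  { intros s Hs; apply is_derive_on_plus; [apply is_derive_on_plus|];
      apply (is_derive_on_mult a b s Hs); auto. }
  (* First integration: [D'] and [S / sqrt N] share their derivative and their value at [a]. *)
  assert (HD'eq : forall s, Icc a b s -> D' s =
    (x s * x' s + y s * y' s + z s * z' s)
    * / sqrt (x s ^ 2 + y s ^ 2 + z s ^ 2)).
  { eapply is_derive_on_unique; [exact HD'| |exact HD'a].
    intros s Hs; cbv beta.
    eapply is_derive_on_eq;
      [|exact (is_derive_on_mult a b s Hs _ _ _ _ (HS s Hs)
                 (is_derive_on_inv_sqrt a b s Hs _ _ (Hpos s Hs) (HN s Hs)))].
    pose proof (Hpos s Hs) as Hp; pose proof (sqrt_lt_R0 _ Hp).
    replace (1 / 2) with (/ 2) by lra.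
    rewrite !Rpower_Ropp, Rpower_3_2, Rpower_sqrt by exact Hp.
    field; split; lra. }
  (* Second integration: the derivative of [sqrt N] is [S / sqrt N], now known to be [D']. *)
  eapply is_derive_on_unique; [exact HD| |exact HDa].
  intros s Hs; cbv beta.
  eapply is_derive_on_eq;
    [|exact (is_derive_on_sqrt a b s Hs _ _ (Hpos s Hs) (HN s Hs))].
  rewrite HD'eq by exact Hs.
  pose proof (sqrt_lt_R0 _ (Hpos s Hs)).
  field; lra.
Qed.

(** * Recovering a vector from the rays of its projections and its norm *)

Lemma unit_vec_ray (w v : R3) (k : R) :
  0 < k -> w <> vec3 0 0 0 -> unit_vec w = scal k v ->
  exists p : R, 0 < p /\ w = scal p v.
Proof.
  intros Hk Hw Hu.
  assert (Hn : norm w <> 0) by (intros Hn; exact (Hw (norm_eq_zero w Hn))).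
  pose proof (norm_ge_0 w) as Hn0.
  (* [w] is [norm w] times its unit vector, which in turn is [k] times [v]. *)
  exists (norm w * k); split.
  - apply Rmult_lt_0_compat; lra.
  - transitivity (scal (norm w) (unit_vec w)).
    + unfold unit_vec; rewrite scal_assoc.
      change (mult (norm w) (/ norm w)) with (norm w * / norm w).
      rewrite Rinv_r by exact Hn; symmetry; exact (scal_one w).
    + rewrite Hu; exact (scal_assoc (norm w) k v).
Qed.

Lemma eq_of_proj_rays (x y z a b c p q r : R) :
  ~ (y = 0 /\ z = 0) -> ~ (x = 0 /\ z = 0) -> ~ (x = 0 /\ y = 0) ->
  0 < p -> 0 < q -> 0 < r ->
  a = p * x -> b = p * y -> a = q * x -> c = q * z -> b = r * y -> c = r * z ->
  a ^ 2 + b ^ 2 + c ^ 2 = x ^ 2 + y ^ 2 + z ^ 2 ->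
  a = x /\ b = y /\ c = z.
Proof.
  intros Hyz Hxz Hxy Hp Hq Hr Ha Hb Ha' Hc Hb' Hc' HN.
  assert (Hk : exists k, 0 < k /\ a = k * x /\ b = k * y /\ c = k * z).
  (* If [x = 0], then [a = 0] and the factor [r] of the [y], [z] plane fits all three coordinates.
     Otherwise [p * x = a = q * x] forces [p = q]. *)
  { destruct (Req_dec x 0) as [->|Hx].
    - exists r; repeat split; lra.
    - exists p; repeat split; [lra..|].
      replace p with q; [exact Hc|].
      apply (Rmult_eq_reg_r x); [lra|exact Hx]. }
  destruct Hk as [k [Hk [-> [-> ->]]]].
  assert (Hpos : 0 < x ^ 2 + y ^ 2 + z ^ 2).
  { pose proof (sum_squares_pos _ _ Hxy); pose proof (pow2_ge_0 z); lra. }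
  (* Equal sums of squares give [k^2 * N = N] with [N > 0]; the sign of [k] then excludes
     [k = -1]. *)
  assert (Hk2 : k ^ 2 = 1).
  { apply (Rmult_eq_reg_r (x ^ 2 + y ^ 2 + z ^ 2)); lra. }
  assert (k = 1) as -> by nra.
  repeat split; ring.
Qed.

(** * Coordinates of [R3] as linear maps *)

Definition coord1 (v : R3) : R := fst (fst v).
Definition coord2 (v : R3) : R := snd (fst v).
Definition coord3 (v : R3) : R := snd v.

Lemma R3_eq (v w : R3) :
  coord1 v = coord1 w -> coord2 v = coord2 w -> coord3 v = coord3 w -> v = w.
Proof.
  destruct v as [[v1 v2] v3], w as [[w1 w2] w3]; unfold coord1, coord2, coord3.
  now simpl; intros -> -> ->.
Qed.

(** Through [is_derive_on_linear], linearity of the coordinates turns each vector equation for a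
    unit direction into scalar equations. *)
Lemma is_linear_coord1 : is_linear (U := R3) (V := R_NormedModule) coord1.
Proof. exact (is_linear_comp fst fst is_linear_fst is_linear_fst). Qed.

Lemma is_linear_coord2 : is_linear (U := R3) (V := R_NormedModule) coord2.
Proof. exact (is_linear_comp fst snd is_linear_fst is_linear_snd). Qed.

Lemma is_linear_coord3 : is_linear (U := R3) (V := R_NormedModule) coord3.
Proof. exact is_linear_snd. Qed.

Theorem theorem3p3
  (t0 t1 : R) (Ht : t0 < t1)
  (x y z x' y' z' x'' y'' z'' : R -> R)
  (Hx : is_C2_on t0 t1 x x' x'')
  (Hy : is_C2_on t0 t1 y y' y'')
  (Hz : is_C2_on t0 t1 z z' z'')
  (Hsimple : is_simple_on t0 t1 (fun t => vec3 (x t) (y t) (z t)))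
  (HO : forall t, Icc t0 t1 t -> vec3 (x t) (y t) (z t) <> vec3 0 0 0)
  (Hx_axis : forall t, Icc t0 t1 t -> ~ (y t = 0 /\ z t = 0))
  (Hy_axis : forall t, Icc t0 t1 t -> ~ (x t = 0 /\ z t = 0))
  (Hz_axis : forall t, Icc t0 t1 t -> ~ (x t = 0 /\ y t = 0))
  (OP : R -> R3)
  (HA : forall t, Icc t0 t1 t -> proj_A (OP t) <> vec3 0 0 0)
  (HB : forall t, Icc t0 t1 t -> proj_B (OP t) <> vec3 0 0 0)
  (HC : forall t, Icc t0 t1 t -> proj_C (OP t) <> vec3 0 0 0)
  (D' : R -> R)
  (HD1 : forall t, Icc t0 t1 t ->
     is_derive_on t0 t1 (fun s => norm (OP s)) t (D' t))
  (HD2 : forall t, Icc t0 t1 t ->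
     is_derive_on t0 t1 D' t
       (- Rpower (x t ^ 2 + y t ^ 2 + z t ^ 2) (- (3 / 2))
          * (x t * x' t + y t * y' t + z t * z' t) ^ 2
        + Rpower (x t ^ 2 + y t ^ 2 + z t ^ 2) (- (1 / 2))
          * (x' t ^ 2 + x t * x'' t + y' t ^ 2 + y t * y'' t
             + z' t ^ 2 + z t * z'' t)))
  (HD1_init : D' t0 =
     (x t0 * x' t0 + y t0 * y' t0 + z t0 * z' t0)
     / sqrt (x t0 ^ 2 + y t0 ^ 2 + z t0 ^ 2))
  (HD_init : norm (OP t0) = sqrt (x t0 ^ 2 + y t0 ^ 2 + z t0 ^ 2))
  (HeA : forall t, Icc t0 t1 t ->
     is_derive_on t0 t1 (fun s => unit_vec (proj_A (OP s))) t
       (scal (x t * y' t - x' t * y t)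
          (scal (/ Rpower (x t ^ 2 + y t ^ 2) (3 / 2))
             (vec3 (- y t) (x t) 0))))
  (HeA_init : unit_vec (proj_A (OP t0)) =
     scal (/ sqrt (x t0 ^ 2 + y t0 ^ 2)) (vec3 (x t0) (y t0) 0))
  (HeB : forall t, Icc t0 t1 t ->
     is_derive_on t0 t1 (fun s => unit_vec (proj_B (OP s))) t
       (scal (x t * z' t - x' t * z t)
          (scal (/ Rpower (x t ^ 2 + z t ^ 2) (3 / 2))
             (vec3 (- z t) 0 (x t)))))
  (HeB_init : unit_vec (proj_B (OP t0)) =
     scal (/ sqrt (x t0 ^ 2 + z t0 ^ 2)) (vec3 (x t0) 0 (z t0)))
  (HeC : forall t, Icc t0 t1 t ->
     is_derive_on t0 t1 (fun s => unit_vec (proj_C (OP s))) t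
       (scal (y t * z' t - y' t * z t)
          (scal (/ Rpower (y t ^ 2 + z t ^ 2) (3 / 2))
             (vec3 0 (- z t) (y t)))))
  (HeC_init : unit_vec (proj_C (OP t0)) =
     scal (/ sqrt (y t0 ^ 2 + z t0 ^ 2)) (vec3 0 (y t0) (z t0))) :
  forall t, Icc t0 t1 t -> OP t = vec3 (x t) (y t) (z t).
Proof.
  assert (Hrho : forall u v : R, ~ (u = 0 /\ v = 0) -> 0 < / sqrt (u ^ 2 + v ^ 2)).
  { intros u v Huv; apply Rinv_0_lt_compat, sqrt_lt_R0.
    now apply sum_squares_pos. }
  assert (Hpos : forall t, Icc t0 t1 t -> 0 < x t ^ 2 + y t ^ 2 + z t ^ 2).
  { intros t It; pose proof (sum_squares_pos _ _ (Hz_axis t It)).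
    pose proof (pow2_ge_0 (z t)); lra. }
  pose proof (distance_unique t0 t1 x y z x' y' z' x'' y'' z''
    (fun s => norm (OP s)) D' Hpos Hx Hy Hz HD1 HD2 HD1_init HD_init) as HD.
  destruct Hx as [Hx _], Hy as [Hy _], Hz as [Hz _].
  (* In each plane the two in-plane coordinates of the vector equation are, up to conversion, the
     scalar hypotheses of [direction_unique]. *)
  pose proof (direction_unique t0 t1 x y x' y' _ _ Hz_axis Hx Hy
    (fun s Is => is_derive_on_linear _ _ _ _ _ _ is_linear_coord1 (HeA s Is))
    (fun s Is => is_derive_on_linear _ _ _ _ _ _ is_linear_coord2 (HeA s Is))
    (f_equal coord1 HeA_init) (f_equal coord2 HeA_init)) as HdA.
  pose proof (direction_unique t0 t1 x z x' z' _ _ Hy_axis Hx Hz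
    (fun s Is => is_derive_on_linear _ _ _ _ _ _ is_linear_coord1 (HeB s Is))
    (fun s Is => is_derive_on_linear _ _ _ _ _ _ is_linear_coord3 (HeB s Is))
    (f_equal coord1 HeB_init) (f_equal coord3 HeB_init)) as HdB.
  pose proof (direction_unique t0 t1 y z y' z' _ _ Hx_axis Hy Hz
    (fun s Is => is_derive_on_linear _ _ _ _ _ _ is_linear_coord2 (HeC s Is))
    (fun s Is => is_derive_on_linear _ _ _ _ _ _ is_linear_coord3 (HeC s Is))
    (f_equal coord2 HeC_init) (f_equal coord3 HeC_init)) as HdC.
  intros t It.
  specialize (HD t It); specialize (Hx_axis t It);
    specialize (Hy_axis t It); specialize (Hz_axis t It).
  destruct (HdA t It) as [HA1 HA2], (HdB t It) as [HB1 HB3],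
    (HdC t It) as [HC2 HC3].
  (* The factor [k] is the reciprocal of the norm of the projected curve point, positive by [Hrho]
     because the curve avoids the axis normal to the plane. *)
  destruct (unit_vec_ray (proj_A (OP t)) (vec3 (x t) (y t) 0) _
    (Hrho _ _ Hz_axis) (HA t It)) as [p [Hp HpA]].
  { apply R3_eq; [exact HA1 | exact HA2 |].
    (* The coordinate normal to the plane is a multiple of [0] on both sides. *)
    exact (eq_trans (Rmult_0_r _) (eq_sym (Rmult_0_r _))). }
  destruct (unit_vec_ray (proj_B (OP t)) (vec3 (x t) 0 (z t)) _
    (Hrho _ _ Hy_axis) (HB t It)) as [q [Hq HqB]].
  { apply R3_eq; [exact HB1 | | exact HB3].
    exact (eq_trans (Rmult_0_r _) (eq_sym (Rmult_0_r _))). }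
  destruct (unit_vec_ray (proj_C (OP t)) (vec3 0 (y t) (z t)) _
    (Hrho _ _ Hx_axis) (HC t It)) as [r [Hr HrC]].
  { apply R3_eq; [| exact HC2 | exact HC3].
    exact (eq_trans (Rmult_0_r _) (eq_sym (Rmult_0_r _))). }
  destruct (eq_of_proj_rays (x t) (y t) (z t)
    (coord1 (OP t)) (coord2 (OP t)) (coord3 (OP t)) p q r
    Hx_axis Hy_axis Hz_axis Hp Hq Hr
    (f_equal coord1 HpA) (f_equal coord2 HpA)
    (f_equal coord1 HqB) (f_equal coord3 HqB)
    (f_equal coord2 HrC) (f_equal coord3 HrC)) as [H1 [H2 H3]].
  (* The equality of sums of squares is read off under the root, where both sides are [norm (OP t)]
     by [norm_vec3] and [HD]. *)
  - apply sqrt_inj; [nra | nra |].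
    rewrite <- HD, <- norm_vec3; f_equal.
    now apply R3_eq.
  - now apply R3_eq.
Qed.
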